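(* The entropy functional $\mathcal{H}$ is continuous on categorical probabilistic triples: for every sequence $\{(\mathbf{A}_k,p_k,\phi_k)\}_{k\in\mathbb{N}}$ of categorical probabilistic triples that converges to a categorical probabilistic triple $(\mathbf{A},p,\phi)$, the sequence $\{\mathcal{H}(\mathbf{A}_k,p_k,\phi_k)\}_{k\in\mathbb{N}}$ converges to $\mathcal{H}(\mathbf{A},p,\phi)$.
   Context: A categorical probabilistic triple $(\mathbf{A},p,\phi)$ consists of (1) a finite category $\mathbf{A}$; (2) a probability $p$ on the finite set $\operatorname{Ob}(\mathbf{A})$; (3) a function $\phi:\operatorname{Ob}(\mathbf{A})\times\operatorname{Ob}(\mathbf{A})\to[0,\infty)$ such that $\phi(a,a)>0$ for all objects $a$, and $\phi(b,b')=0$ whenever there is no arrow from $b$ to $b'$ in $\mathbf{A}$. The categorical entropy of a triple is $$\mathcal{H}(\mathbf{A},p,\phi):=-\sum_{a\in\operatorname{Ob}(\mathbf{A})}p(a)\ln\Big(\sum_{b\in\operatorname{Ob}(\mathbf{A})}p(b)\phi(a,b)\Big),$$ with the convention that the summand indexed by $a$ is $0$ whenever $p(a)=0$. A sequence $\{(\mathbf{A}_k,p_k,\phi_k)\}_{k\in\mathbb{N}}$ of categorical probabilistic triples converges to a categorical probabilistic triple $(\mathbf{A},p,\phi)$ if $\mathbf{A}_k=\mathbf{A}$ for all sufficiently large $k$, and $\{p_k\}_k$ and $\{\phi_k\}_k$ converge pointwise, as sequences of functions, to $p$ and $\phi$ respectively. *)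

(* Defs.v *)
From HB Require Import structures.
From mathcomp Require Import all_boot all_order all_algebra.
From mathcomp Require Import all_classical all_reals all_analysis.

Set Implicit Arguments.
Unset Strict Implicit.
Unset Printing Implicit Defensive.

Import Order.TTheory GRing.Theory Num.Theory.
Import numFieldNormedType.Exports.

Local Open Scope classical_set_scope.
Local Open Scope ring_scope.

(* Objects and arrows form bare types and finiteness is a proposition (rather
   than a [finType] structure), so that Leibniz equality of two categories is
   equality of objects, arrows, identities and composition only: it does not
   also require a chosen enumeration to be the same.
   Composition is written in diagrammatic order. *)
Record finCategory := FinCategory {
  ob : Type;
  hom : ob -> ob -> Type;
  idmap : forall a, hom a a;
  compose : forall a b c, hom a b -> hom b c -> hom a c;
  compose_idl : forall a b (f : hom a b), compose (idmap a) f = f;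
  compose_idr : forall a b (f : hom a b), compose f (idmap b) = f;
  composeA : forall a b c d (f : hom a b) (g : hom b c) (h : hom c d),
    compose f (compose g h) = compose (compose f g) h;
  finite_ob : finite_set [set: ob];
  finite_hom : forall a b, finite_set [set: hom a b]
}.

(* [{classic T}] is [T] with its classical choice structure, which is what
   finitely supported sums require of the index type. *)
Definition sum_ob (R : realType) (A : finCategory) (F : ob A -> R) : R :=
  \sum_(a \in [set: {classic (ob A)}]) F a.

Record catTriple (R : realType) := CatTriple {
  base : finCategory;
  prob : ob base -> R;
  phi : ob base -> ob base -> R;
  prob_ge0 : forall a, 0 <= prob a;
  prob_sum1 : sum_ob prob = 1;
  phi_ge0 : forall a b, 0 <= phi a b;
  phi_diag_gt0 : forall a, 0 < phi a a;
  phi_no_arrow : forall b b', ~ inhabited (hom b b') -> phi b b' = 0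
}.
Arguments prob {R} _ _.
Arguments phi {R} _ _ _.

(* The summand at [a] is [0] when [prob a = 0], since [0 * x = 0]. When
   [prob a] is positive the argument of [ln] is positive. *)
Definition entropy (R : realType) (T : catTriple R) : R :=
  - sum_ob (fun a => prob T a * ln (sum_ob (fun b => prob T b * phi T a b))).

(* The values [p_k a] and [phi_k a b] at objects of the limit category only
   make sense once the [k]-th category equals the limit category; convergence
   is therefore that of the tail beyond [N], objects of the limit category
   being transported along the equality of categories. *)
Definition triple_cvg (R : realType) (T : nat -> catTriple R) (L : catTriple R) :=
  exists (N : nat) (e : forall k, base (T (k + N)%N) = base L),
    (forall a : ob (base L),
       (fun k => prob (T (k + N)%N) (eq_rect_r ob a (e k))) @ \oo
         --> prob L a) /\
    (forall a b : ob (base L),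
       (fun k => phi (T (k + N)%N) (eq_rect_r ob a (e k))
                                   (eq_rect_r ob b (e k))) @ \oo
         --> phi L a b).

(* Main.v *)
Require Import Defs.
From HB Require Import structures.
From mathcomp Require Import all_boot all_order all_algebra.
From mathcomp Require Import all_classical all_reals all_analysis.
Import Order.TTheory GRing.Theory Num.Theory.
Import numFieldNormedType.Exports.
Local Open Scope classical_set_scope.
Local Open Scope ring_scope.

(** The entropy is a finite sum of terms [p a * ln (S a)] with
    [S a = \sum_b p b * phi a b], so it is enough to pass to the limit in each
    term. This is plain continuity of [ln] where the limit weight [p a] is
    positive, because [S a >= p a * phi a a] then keeps [S a] away from [0].

    Where the limit weight is [0], the weights along the sequence may be
    positive while [S a] tends to [0], so that [ln (S a)] diverges. The diagonal
    bound [S a >= p a * phi a a] again decides: together with [ln x <= x] it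
    gives [`|p a * ln (S a)| <= p a * S a + 2 * sqrt (p a / phi a a)]
    ([normr_mul_ln_le]), and the right-hand side tends to [0] since the limit of
    [phi a a] is positive. [cvg_mul_ln] covers both cases.

    Finally, the entropy can be computed after transport along an equality of
    categories ([entropy_transport]), which brings the tail of the sequence
    onto the objects of the limit category. *)

(** The upper estimate is [ln S <= S]; the lower one is the same inequality
    applied to [1 / sqrt S], that is [ln S >= - 2 / sqrt S], after which
    [p / sqrt S <= p / sqrt (p * c)] is still small with [p]. *)
Lemma normr_mul_ln_le {R : realType} (p c S : R) :
  0 <= p -> 0 < c -> p * c <= S ->
  `|p * ln S| <= p * S + 2 * Num.sqrt (p / c).
Proof.
move=> p_ge0 c_gt0 pcS.
have [->|p_neq0] := eqVneq p 0.
  by rewrite !mul0r normr0 add0r mulr_ge0 ?sqrtr_ge0.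
have p_gt0 : 0 < p by rewrite lt_neqAle eq_sym p_neq0.
have S_gt0 : 0 < S by apply: lt_le_trans pcS; rewrite mulr_gt0.
set s := Num.sqrt S.
have s_gt0 : 0 < s by rewrite sqrtr_gt0.
have lnS : - (2 * s^-1) <= ln S.
  have -> : ln S = - (2 * ln s^-1).
    by rewrite lnV ?posrE// mulrN opprK -[S]sqr_sqrtr ?ltW// lnXn// mulr_natl.
  by rewrite lerN2 ler_wpM2l// ltW// ln_sublinear// invr_gt0.
have ps : p * s^-1 <= Num.sqrt (p / c).
  rewrite ler_pdivrMr// -sqrtrM; last by rewrite divr_ge0 ?ltW.
  rewrite -[leLHS]ger0_norm// -sqrtr_sqr ler_wsqrtr//.
  by rewrite expr2 -mulrA ler_wpM2l// mulrC ler_pdivlMr.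
rewrite ler_norml; apply/andP; split.
  rewrite lerNl -mulrN (le_trans (y := 2 * Num.sqrt (p / c)))//.
    rewrite (le_trans (y := p * (2 * s^-1)))//.
      by rewrite ler_wpM2l// lerNl.
    by rewrite mulrCA ler_wpM2l.
  by rewrite lerDr mulr_ge0// ltW.
rewrite (le_trans (y := p * S))//.
  by rewrite ler_wpM2l// ltW// ln_sublinear.
by rewrite lerDl mulr_ge0// sqrtr_ge0.
Qed.

(** The function [(p, S) |-> p * ln S] is not continuous at [(0, 0)]: it is
    constantly [-1] along [S = expR (- p^-1)]. The lower bound [p * c <= S] with
    [c] converging to a positive limit excludes such approaches. *)
Lemma cvg_mul_ln {R : realType} {I : Type} {F : set_system I}
    {FF : ProperFilter F} (p c S : I -> R) (p0 c0 S0 : R) :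
  p @ F --> p0 -> c @ F --> c0 -> S @ F --> S0 -> 0 < c0 ->
  (forall t, 0 <= p t) -> (forall t, 0 < c t) ->
  (forall t, p t * c t <= S t) ->
  p t * ln (S t) @[t --> F] --> p0 * ln S0.
Proof.
move=> pp0 cc0 SS0 c0_gt0 p_ge0 c_gt0 pcS.
have lim_ge0 (f : I -> R) l : f @ F --> l -> (forall t, 0 <= f t) -> 0 <= l.
  move=> fl f_ge0; rewrite -(cvg_lim _ fl)//.
  by apply: limr_ge (cvgP _ fl) _; exact: nearW.
have p0_ge0 : 0 <= p0 by exact: lim_ge0 pp0 p_ge0.
have pcS0 : p0 * c0 <= S0.
  rewrite -subr_ge0; apply: (lim_ge0 (fun t => S t - p t * c t)).
    by apply: cvgB => //; exact: cvgM.
  by move=> t; rewrite subr_ge0.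
have [p0_eq0|p0_neq0] := eqVneq p0 0; last first.
  have S0_gt0 : 0 < S0.
    by apply: lt_le_trans pcS0; rewrite mulr_gt0// lt_neqAle eq_sym p0_neq0.
  by apply: cvgM => //; apply: continuous_cvg => //; exact: continuous_ln.
(* The limit weight vanishes: squeeze between 0 and the bound of
   [normr_mul_ln_le]. *)
rewrite p0_eq0 mul0r; apply: norm_cvg0.
apply: (@squeeze_cvgr _ _ _ _ (cst 0)
  (fun t => p t * S t + 2 * Num.sqrt (p t / c t))).
- by apply: nearW => t; rewrite normr_ge0 normr_mul_ln_le.
- exact: cvg_cst.
have -> : 0 = p0 * S0 + 2 * Num.sqrt (p0 / c0) :> R.
  by rewrite p0_eq0 !mul0r sqrtr0 mulr0 addr0.
apply: cvgD; first exact: cvgM.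
apply: cvgM; first exact: cvg_cst.
apply: continuous_cvg; first exact: sqrt_continuous.
by apply: cvgM => //; apply: cvgV => //; rewrite gt_eqF.
Qed.

Lemma finite_ob_classic (A : finCategory) :
  finite_set [set: {classic (ob A)}].
Proof. exact: finite_ob. Qed.

Lemma sum_ob_cvg {R : realType} {A : finCategory} {I : Type}
    {F : set_system I} {FF : Filter F} (f : I -> ob A -> R) (g : ob A -> R) :
  (forall a, f t a @[t --> F] --> g a) ->
  sum_ob (f t) @[t --> F] --> sum_ob g.
Proof.
move=> fg.
have [r sumE] : exists r : seq {classic (ob A)},
    forall h : ob A -> R, sum_ob h = \sum_(a <- r) h a.
  by eexists => h; exact/fsbig_finite/finite_ob_classic.
under eq_fun do rewrite sumE.
by rewrite sumE; apply: cvg_big => //; exact: add_continuous.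
Qed.

Lemma ler_sum_ob_term {R : realType} {A : finCategory} (f : ob A -> R)
    (a : ob A) :
  (forall b, 0 <= f b) -> f a <= sum_ob f.
Proof.
move=> f_ge0; rewrite /sum_ob (fsbigD1 (a : {classic (ob A)}))//=.
  by rewrite lerDl fsumr_ge0.
exact: finite_ob_classic.
Qed.

(** Stated for an arbitrary [A] equal to [base X], so that the equality can be
    eliminated; it is used with [A] the limit category, where the transported
    functions of all the triples of the tail have the same domain. *)
Lemma entropy_transport {R : realType} {A : finCategory} (X : catTriple R)
    (e : base X = A) :
  entropy X = - sum_ob (fun a : ob A =>
    prob X (eq_rect_r ob a e) *
    ln (sum_ob (fun b : ob A => prob X (eq_rect_r ob b e) *
      phi X (eq_rect_r ob a e) (eq_rect_r ob b e)))).
Proof. by case: A / e. Qed.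

Theorem proposition5 (R : realType) (T : nat -> catTriple R) (L : catTriple R) :
  triple_cvg T L -> (fun k => entropy (T k)) @ \oo --> entropy L.
Proof.
move=> [N [e [cvg_prob cvg_phi]]].
rewrite -(cvg_shiftn N) /=.
under eq_fun do rewrite (entropy_transport (T _) (e _)).
apply: cvgN; apply: sum_ob_cvg => a.
apply: (@cvg_mul_ln _ _ _ _ _
  (fun k => phi (T (k + N)%N) (eq_rect_r ob a (e k)) (eq_rect_r ob a (e k)))
  _ _ (phi L a a)).
- exact: cvg_prob.
- exact: cvg_phi.
- by apply: sum_ob_cvg => b; apply: cvgM; [exact: cvg_prob|exact: cvg_phi].
- exact: phi_diag_gt0.
- by move=> k; exact: prob_ge0.
- by move=> k; exact: phi_diag_gt0.
move=> k.
pose f b := prob (T (k + N)%N) (eq_rect_r ob b (e k)) *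
  phi (T (k + N)%N) (eq_rect_r ob a (e k)) (eq_rect_r ob b (e k)).
apply: (@ler_sum_ob_term _ _ f a) => b.
by rewrite mulr_ge0 ?prob_ge0 ?phi_ge0.
Qed.
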